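(* Given a safe loop invariant $I$ and a correct summary $R$ for a loop $W(t,B)$ with respect to precondition $P$ and postcondition $Q$, the Hoare triple $\{P\}\,W(t,B)\,\{Q\}$ is valid, i.e. $\models \{P\}\,W(t,B)\,\{Q\}$.
   Context: States form a set $S$. Commands are relations $C \subseteq S \times \hat S$ with $\hat S = S \uplus \{\mathsf{err}\} \uplus \{\mathrm{brk}(s) \mid s \in S\}$, where $\mathsf{err}$ denotes a runtime error outcome and $\mathrm{brk}(s)$ denotes early exit of a loop via a break command in state $s$; $s,s',s_0,s_n$ range over $S$ and $\hat s$ over $\hat S$. Validity: $\models \{P\}\,C\,\{Q\}$ iff for all $s,\hat s'$, $P(s) \land C(s,\hat s') \implies Q(\hat s')$, where $P,Q \subseteq S$ (so $\hat s'$ must be a regular state). The loop $W(t,B)\subseteq S\times\hat S$ with test $t\subseteq S$ and body $B\subseteq S\times\hat S$ is the least relation satisfying: $\lnot t(s) \implies W(t,B)(s,s)$; $t(s)\land B(s,\mathsf{err}) \implies W(t,B)(s,\mathsf{err})$; $t(s)\land B(s,\mathrm{brk}(s')) \implies W(t,B)(s,s')$; $t(s)\land B(s,s')\land W(t,B)(s',\hat s'') \implies W(t,B)(s,\hat s'')$. A predicate $I\subseteq S$ is an invariant w.r.t. $P$ if $P(s_0)\implies I(s_0)$ and $I(s)\land t(s)\land B(s,s')\implies I(s')$; it is safe if additionally $I(s)\land t(s)\land B(s,\mathsf{err})\implies \mathit{false}$. A relation $R\subseteq S\times S$ is a summary of $W(t,B)$ if $\lnot t(s_n)\implies R(s_n,s_n)$;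 $t(s)\land B(s,\mathrm{brk}(s_n))\implies R(s,s_n)$; $t(s)\land B(s,s')\land R(s',s_n)\implies R(s,s_n)$. A summary is correct w.r.t. $P$ and $Q$ if also $P(s_0)\land R(s_0,s_n)\implies Q(s_n)$. *)

(* Defs.v *)
Set Implicit Arguments.

Inductive outcome (S : Type) : Type :=
| Reg (s : S)
| Err
| Brk (s : S).
Arguments Err {S}.

Definition assertion (S : Type) : Type := S -> Prop.

Definition command (S : Type) : Type := S -> outcome S -> Prop.

(* A subset of S seen as a subset of [outcome S]: it contains regular states
   only, so a valid triple rules out both [Err] and [Brk] outcomes. *)
Definition on_outcome (S : Type) (Q : assertion S) (o : outcome S) : Prop :=
  match o with
  | Reg s => Q s
  | Err => False
  | Brk _ => False
  end.

Definition valid (S : Type) (P : assertion S) (C : command S) (Q : assertion S) : Prop :=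
  forall (s : S) (o : outcome S), P s /\ C s o -> on_outcome Q o.

Inductive while (S : Type) (t : assertion S) (B : command S) : command S :=
| while_exit : forall s, ~ t s -> while t B s (Reg s)
| while_err : forall s, t s -> B s Err -> while t B s Err
| while_brk : forall s s', t s -> B s (Brk s') -> while t B s (Reg s')
| while_step : forall s s' o,
    t s -> B s (Reg s') -> while t B s' o -> while t B s o.

Definition invariant (S : Type) (t : assertion S) (B : command S)
    (P I : assertion S) : Prop :=
  (forall s0, P s0 -> I s0) /\
  (forall s s', I s /\ t s /\ B s (Reg s') -> I s').

Definition safe_invariant (S : Type) (t : assertion S) (B : command S)
    (P I : assertion S) : Prop :=
  invariant t B P I /\
  (forall s, I s /\ t s /\ B s Err -> False).

Definition summary (S : Type) (t : assertion S) (B : command S)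
    (R : S -> S -> Prop) : Prop :=
  (forall sn, ~ t sn -> R sn sn) /\
  (forall s sn, t s /\ B s (Brk sn) -> R s sn) /\
  (forall s s' sn, t s /\ B s (Reg s') /\ R s' sn -> R s sn).

Definition correct_summary (S : Type) (t : assertion S) (B : command S)
    (P Q : assertion S) (R : S -> S -> Prop) : Prop :=
  summary t B R /\
  (forall s0 sn, P s0 /\ R s0 sn -> Q sn).

(* Main.v *)
Require Import Defs.

(** Induction on the derivation of [while]: [I] is carried forward through the iterations and
    excludes [Err], while [R] is built backward from the exit. So runs from [I] end in regular
    states [R]-related to their start; correctness of [R] gives [Q]. *)

Lemma while_summary (S : Type) (t : assertion S) (B : command S)
    (P I : assertion S) (R : S -> S -> Prop) (s : S) (o : outcome S) :
  safe_invariant t B P I -> summary t B R ->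
  while t B s o -> I s -> on_outcome (R s) o.
Proof.
  intros [[_ Istep] Isafe] (Rexit & Rbrk & Rstep) W.
  induction W as [s nts | s ts Bs | s s' ts Bs | s s' o ts Bs W IH];
    intros Is; simpl.
  - auto.
  - eauto.
  - auto.
  - assert (Is' : I s') by eauto.
    specialize (IH Is').
    (* For a regular [o], [Rstep] prepends the iteration; otherwise [IH] is already [False]. *)
    destruct o; simpl in *; eauto.
Qed.

Theorem theorem3 (S : Type) (t : assertion S) (B : command S) (P Q : assertion S)
    (I : assertion S) (R : S -> S -> Prop)
    (hI : safe_invariant t B P I)
    (hR : correct_summary t B P Q R) :
  valid P (while t B) Q.
Proof.
  intros s o [Ps W].
  destruct hR as [Rsum RQ].
  assert (Is : I s) by (apply hI; exact Ps).
  pose proof (while_summary _ _ _ _ _ _ _ _ hI Rsum W Is) as H.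
  destruct o; simpl in *; eauto.
Qed.
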